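(* $$\sum_{n=0}^{\infty}RD_3^{3,27}(3n+2)q^n\equiv0\pmod{3^2},$$ i.e. $RD_3^{3,27}(3n+2)\equiv0\pmod{9}$ for all integers $n\ge0$.
   Context: For $r\ge1$, $E_r=\prod_{n=1}^{\infty}(1-q^{nr})$, $|q|<1$ (or as a formal power series in $q$). For positive integers $\ell,t,k$, $RD_k^{\ell,t}(n)$ denotes the number of partitions of $n$ in which each part carries one of $k$ colors, no part is divisible by $\ell$, and each colored part appears fewer than $t$ times; its generating function is $$\sum_{n=0}^{\infty}RD_k^{\ell,t}(n)q^n=\left(\frac{E_\ell E_t}{E_1E_{\ell t}}\right)^k.$$ In particular $\sum_{n\ge0}RD_3^{3,27}(n)q^n=\left(\frac{E_3E_{27}}{E_1E_{81}}\right)^3$. A congruence between power series means congruence of all coefficients. *)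

(* Defs.v *)
From mathcomp Require Import all_boot.

Set Implicit Arguments.
Unset Strict Implicit.
Unset Printing Implicit Defensive.

(* A partition of n whose parts carry one of k colors is encoded by its
   multiplicities: m (i, c) is the number of occurrences of the part i.+1
   in color c.  Parts and multiplicities of a partition of n are at most n,
   so taking i : 'I_n and m (i, c) : 'I_n.+1 loses no partition. *)
Definition colored_mult (n k : nat) := {ffun 'I_n * 'I_k -> 'I_n.+1}.

Definition is_colored_partition (n k : nat) (m : colored_mult n k) : bool :=
  \sum_(i < n) \sum_(c < k) i.+1 * m (i, c) == n.

(* A part occurs in m when it has positive multiplicity in some color. *)
Definition no_part_divisible (l n k : nat) (m : colored_mult n k) : bool :=
  [forall i : 'I_n, forall c : 'I_k, (0 < m (i, c)) ==> ~~ (l %| i.+1)].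

Definition colored_parts_fewer_than (t n k : nat) (m : colored_mult n k) : bool :=
  [forall i : 'I_n, forall c : 'I_k, m (i, c) < t].

Definition RD (k l t n : nat) : nat :=
  #|[set m : colored_mult n k | [&& is_colored_partition m,
       no_part_divisible l m & colored_parts_fewer_than t m]]|.

(* Main.v *)
Require Import Defs.
From mathcomp Require Import all_boot.
From mathcomp Require Import all_algebra.
From mathcomp Require Import ring zify.

(** Let G be the generating function of the uncolored partitions with no part
    divisible by l and multiplicities below t, so that F = G^3 counts the
    partitions in three colors, and let theta = q d/dq.  Then
    theta F = 3 G^2 theta G, that is, n a(n) = 3 [q^n] (G^2 theta G) for the
    coefficients a(n) of F.  If n = 2 mod 3, then n is invertible mod 9, and
    9 | a(n) follows once 3 divides [q^n] (G^2 theta G).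

    That coefficient is computed over the field with three elements, where
    G^2 theta G = G^3 L for the logarithmic derivative L = theta G / G.  When 3
    divides l and t, two things happen in characteristic 3.
    - Each factor (1 - q^(it)) / (1 - q^i) of G has logarithmic derivative
      i q^i / (1 - q^i), because the numerator has derivative zero.  This is
      zero if 3 | i, so the absence of the parts divisible by l is not felt,
      and L = sum_k sigma(k) q^k, where sigma(k) is the sum of the divisors of k.
      If k = 2 mod 3, two complementary divisors of k are 1 and 2 mod 3, so
      sigma(k) = 0 ([sum_log_deriv_coef]).
    - The cube G^3 is a series in q^3 ([coef_cube]).
    So a term [q^j] G^3 * [q^(n-j)] L with n = 2 mod 3 vanishes: by the second
    fact if j is not divisible by 3, and by the first if it is.

    To stay with polynomials, only the parts and multiplicities that occur in
    partitions of n are kept.  This changes no coefficient up to q^n, so the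
    identity theta G = G L is used as a congruence modulo q^(n+1). *)

Set Implicit Arguments.
Unset Strict Implicit.
Unset Printing Implicit Defensive.

Import GRing.Theory.
Local Open Scope ring_scope.

(** * Generating polynomials *)

(** The index i stands for the part i.+1, as in [colored_mult]. *)
Definition part_ok (l t i j : nat) : bool :=
  ((0 < j)%N ==> ~~ (l %| i.+1)%N) && (j < t)%N.

Definition part_gf (R : nzRingType) (l t n i : nat) : {poly R} :=
  \sum_(j < n.+1 | part_ok l t i j) 'X^(i.+1 * j).

Definition partition_gf (R : comNzRingType) (l t n : nat) : {poly R} :=
  \prod_(i < n) part_gf R l t n i.

(** Expanding the product over all pairs (part, color) gives one monomial for
    each choice of multiplicities, of degree the integer that is partitioned. *)
Lemma RD_coef (R : comNzRingType) (k l t n : nat) :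
  (RD k l t n)%:R = (partition_gf R l t n ^+ k)`_n.
Proof.
have -> : partition_gf R l t n ^+ k = \sum_(m : colored_mult n k |
    [forall p : 'I_n * 'I_k, part_ok l t p.1 (m p)])
      'X^(\sum_(p : 'I_n * 'I_k) p.1.+1 * m p)%N.
  have -> : partition_gf R l t n ^+ k =
      \prod_(p : 'I_n * 'I_k) part_gf R l t n p.1.
    rewrite -(pair_bigA _ (fun (i : 'I_n) (_ : 'I_k) => part_gf R l t n i)) /=.
    by rewrite -prodrXl; apply: eq_bigr => i _; rewrite prodr_const card_ord.
  rewrite /part_gf (bigA_distr_big_dep (fun (p : 'I_n * 'I_k) (j : 'I_n.+1) =>
    part_ok l t p.1 (val j))) /=.
  apply: eq_big => [m | m _]; last by rewrite prodrXr.
  by apply/familyP/forallP => H p; have := H p.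
rewrite coef_sum /RD -sum1_card natr_sum.
under [in RHS]eq_bigr do rewrite coefXn mulrb.
rewrite -big_mkcondr /=; apply: eq_bigl => m.
rewrite inE /is_colored_partition pair_bigA /= andbC eq_sym.
congr (_ && _); last first.
  by congr (_ == _); apply: eq_bigr => [[]].
apply/andP/forallP => [[/forallP H1 /forallP H2] [i c] | H].
  by rewrite /part_ok (forallP (H1 i) c) (forallP (H2 i) c).
by split; apply/forallP => i; apply/forallP => c; case/andP: (H (i, c)).
Qed.

(** * Logarithmic derivatives modulo a power of the variable *)

(** The Euler operator q d/dq: unlike d/dq, it acts on each coefficient
    separately and keeps the degree. *)
Definition theta (R : nzRingType) (p : {poly R}) : {poly R} := 'X * p^`().

Lemma coef_theta (R : nzRingType) (p : {poly R}) m :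
  (theta p)`_m = p`_m *+ m.
Proof. by rewrite coefXM; case: m => [|m]; rewrite ?mulr0n //= coef_deriv. Qed.

Lemma thetaM (R : comNzRingType) (p q : {poly R}) :
  theta (p * q) = theta p * q + p * theta q.
Proof. by rewrite /theta derivM; ring. Qed.

Lemma thetaXn (R : comNzRingType) k :
  theta 'X^k = k%:R%:P * 'X^k :> {poly R}.
Proof.
apply/polyP => m; rewrite coef_theta coefCM coefXn.
by case: eqP => [->|_]; rewrite ?mul0rn ?mulr0 ?mulr1.
Qed.

(** A division-free form of L = theta p / p, up to and including degree n. *)
Definition is_log_deriv (R : idomainType) (n : nat) (p L : {poly R}) : bool :=
  'X^(n.+1) %| theta p - p * L.

(** Products become sums, by the Leibniz rule. *)
Lemma is_log_deriv_prod (R : idomainType) (n : nat) (I : finType)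
    (p L : I -> {poly R}) :
  (forall i, is_log_deriv n (p i) (L i)) ->
  is_log_deriv n (\prod_i p i) (\sum_i L i).
Proof.
move=> pL; apply: (big_ind2 (is_log_deriv n)) => [|q K r M qK rM|i _].
- by rewrite /is_log_deriv /theta derivC !mulr0 subr0 dvdp0.
- rewrite /is_log_deriv thetaM.
  have -> : theta q * r + q * theta r - q * r * (K + M) =
    r * (theta q - q * K) + q * (theta r - r * M) by ring.
  by rewrite dvdp_add ?dvdp_mull.
- exact: pL.
Qed.

(** The series i q^i / (1 - q^i), with i shifted by one, cut off after n terms;
    what is cut off has degree above n. *)
Definition part_log_deriv (R : nzRingType) (n i : nat) : {poly R} :=
  i.+1%:R%:P * \sum_(j < n) 'X^(i.+1 * j.+1).

(** With x = q^i, differentiate (x - 1) P = x^M - 1, where M = min(t, n+1) is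
    the number of multiplicities kept.  The term theta (x^M) = i M x^M is the
    only obstacle to theta P = P * i x / (1 - x); it is zero if M = t, as
    t = 0 in R, and of degree above n if M = n + 1. *)
Lemma part_gf_log_deriv (R : idomainType) (l t n i : nat) :
  l%:R = 0 :> R -> t%:R = 0 :> R ->
  is_log_deriv n (part_gf R l t n i) (part_log_deriv R n i).
Proof.
move=> l0 t0; rewrite /is_log_deriv /part_log_deriv.
(* If the part is zero in R, so is every exponent, and both sides vanish.
   This includes the parts divisible by l, as l = 0 in R. *)
have [i0|iN0] := eqVneq (i.+1%:R : R) 0.
  suff -> : theta (part_gf R l t n i) = 0 by rewrite i0 mul0r mulr0 subr0 dvdp0.
  apply/polyP => m; rewrite coef_theta coef_sum coef0 -sumrMnl big1 // => j _.
  rewrite coefXn; case: eqP => [->|_]; last by rewrite mul0rn.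
  by rewrite natrM i0 mul0r.
have li : ~~ (l %| i.+1)%N.
  by apply: contra iN0 => /dvdnP [u ->]; rewrite natrM l0 mulr0.
set c := i.+1%:R%:P; set x : {poly R} := 'X^(i.+1).
set M := minn t n.+1.
have -> : part_gf R l t n i = \sum_(j < M) x ^+ j.
  rewrite (big_ord_widen n.+1 _ (geq_minr _ _)) /part_gf.
  apply: eq_big => [j|j _]; last by rewrite exprM.
  by rewrite /part_ok li implybT ltn_min ltn_ord andbT.
have -> : \sum_(j < n) 'X^(i.+1 * j.+1) = x * \sum_(j < n) x ^+ j.
  by rewrite mulr_sumr; apply: eq_bigr => j _; rewrite -exprS -exprM.
have geomM := subrX1 x M; have geomS := subrX1 x n.
set P := \sum_(j < M) _ in geomM *; set S := \sum_(j < n) _ in geomS *.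
have /(congr1 (@theta R)) := geomM.
have thx : theta x = c * x by exact: thetaXn.
have thB (q : {poly R}) : theta (q - 1) = theta q.
  by rewrite /theta derivB derivC subr0.
rewrite thetaM !thB thx => eqT.
(* Since x - 1 is a unit modulo q^(n+1), the claim may be multiplied by it. *)
have co : coprimep 'X^(n.+1) (x - 1).
  rewrite coprimep_sym coprimep_expr // coprimepX /root !hornerE.
  by rewrite expr0n /= sub0r oppr_eq0 oner_eq0.
rewrite -(Gauss_dvdpr _ co).
have -> : (x - 1) * (theta P - P * (c * (x * S))) =
    theta (x ^+ M) - c * P * x ^+ n.+1.
  have -> : x ^+ n.+1 = x * (1 + (x - 1) * S) by rewrite -geomS exprS; ring.
  by rewrite eqT; ring.
have dvd_x : 'X^(n.+1) %| x ^+ n.+1 by rewrite -exprM dvdp_exp2l // leq_pmull.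
apply: dvdp_sub; last exact: dvdp_mull.
rewrite -exprM thetaXn natrM.
have [tn|nt] := leqP t n.+1.
  by rewrite /M (minn_idPl tn) t0 mulr0 polyC0 mul0r dvdp0.
by rewrite /M (minn_idPr (ltnW nt)) exprM dvdp_mull.
Qed.

(** * Vanishing in characteristic 3 *)

Lemma pchar3_natr (R : nzRingType) (m : nat) :
  3 \in [pchar R] -> m%:R = (m %% 3)%N%:R :> R.
Proof.
by move=> ch3; rewrite {1}(divn_eq m 3) natrD natrM (pcharf0 ch3) mulr0 add0r.
Qed.

(** The coefficient S is a sum of d over factorizations m = d * d'.  Exchanging
    the two factors shows 2 S to be the sum of the d + d', and d + d' = 0 mod 3
    whenever d * d' = 2 mod 3. *)
Lemma sum_log_deriv_coef (R : idomainType) (n m : nat) :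
  3 \in [pchar R] -> (m %% 3 = 2)%N ->
  (\sum_(i < n) part_log_deriv R n i)`_m = 0.
Proof.
move=> ch3 m2; pose e (i j : nat) : R := (m == i.+1 * j.+1)%N%:R.
have -> : (\sum_(i < n) part_log_deriv R n i)`_m =
    \sum_(i < n) \sum_(j < n) i.+1%:R * e i j.
  rewrite coef_sum; apply: eq_bigr => i _.
  rewrite coefCM coef_sum mulr_sumr; apply: eq_bigr => j _.
  by rewrite coefXn.
set S := \sum_(i < n) _.
have SS : S + S = 0.
  rewrite {2}/S exchange_big -big_split /=; apply: big1 => i _.
  rewrite -big_split /=; apply: big1 => j _.
  rewrite /e [(j.+1 * _)%N]mulnC -mulrDl.
  have [mij|_] := eqVneq m (i.+1 * j.+1)%N; last by rewrite mulr0.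
  rewrite mulr1 -natrD (pchar3_natr _ ch3).
  suff -> : ((i.+1 + j.+1) %% 3 = 0)%N by [].
  move: m2; rewrite mij -modnMm -modnDm.
  have := ltn_pmod i.+1 (isT : 0 < 3)%N; have := ltn_pmod j.+1 (isT : 0 < 3)%N.
  by case: (i.+1 %% 3)%N => [|[|[|]]] //; case: (j.+1 %% 3)%N => [|[|[|]]].
have S3 : S *+ 3 = 0 by rewrite -mulr_natr (pcharf0 ch3) mulr0.
by move: S3; rewrite mulrS mulr2n SS addr0.
Qed.

Lemma theta_cube (R : comNzRingType) (p : {poly R}) :
  theta (p ^+ 3) = (p ^+ 2 * theta p) *+ 3.
Proof. by rewrite exprS thetaM expr2 thetaM; ring. Qed.

(** In characteristic 3 the Euler operator kills a cube, and it multiplies the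
    coefficient of degree m by m. *)
Lemma coef_cube (R : idomainType) (p : {poly R}) (m : nat) :
  3 \in [pchar R] -> ~~ (3 %| m)%N -> (p ^+ 3)`_m = 0.
Proof.
move=> ch3; rewrite (dvdn_pcharf ch3) => mN0; apply/eqP.
have /eqP : (theta (p ^+ 3))`_m = 0.
  by rewrite theta_cube coefMn -mulr_natr (pcharf0 ch3) mulr0.
by rewrite coef_theta -mulr_natr mulf_eq0 (negPf mN0) orbF.
Qed.

(** In characteristic 3, G^2 theta G is G^3 L up to degree n,
    and in each product of a coefficient of G^3 and one of L contributing to
    degree n one of the two is zero. *)
Lemma coef_square_theta (R : idomainType) (l t n : nat) :
  3 \in [pchar R] -> (3 %| l)%N -> (3 %| t)%N -> (n %% 3 = 2)%N ->
  let G := partition_gf R l t n in (G ^+ 2 * theta G)`_n = 0.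
Proof.
move=> ch3 l3 t3 n2 G.
pose L := \sum_(i < n) part_log_deriv R n i.
have GL : is_log_deriv n G L.
  apply: is_log_deriv_prod => i; apply: part_gf_log_deriv; apply/eqP.
    by rewrite -(dvdn_pcharf ch3).
  by rewrite -(dvdn_pcharf ch3).
have -> : G ^+ 2 * theta G = G ^+ 2 * (theta G - G * L) + G ^+ 3 * L by ring.
have /(Pdiv.IdomainMonic.dvdpP (monicXn _ _)) [q ->] := GL.
rewrite mulrA.
rewrite coefD coefMXn ltnSn add0r coefM big1 // => j _.
have [j3|jN3] := boolP (3 %| j)%N; last by rewrite coef_cube ?mul0r.
rewrite sum_log_deriv_coef ?mulr0 //.
by have := ltn_ord j; move/dvdnP: j3 => [u ->]; lia.
Qed.

(** * Divisibility by 9 *)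

(** The integer n a(n) is the coefficient of 3 G^2 theta G: one factor 3 is
    explicit, the other comes from reduction mod 3. *)
Lemma RD_mod9 (l t n : nat) :
  (3 %| l)%N -> (3 %| t)%N -> (n %% 3 = 2)%N -> (9 %| RD 3 l t n)%N.
Proof.
move=> l3 t3 n2; pose G := partition_gf int l t n.
have ch3 : 3 \in [pchar 'F_3] by exact: pchar_Fp.
have mapG : map_poly (intr : int -> 'F_3) G = partition_gf 'F_3 l t n.
  rewrite rmorph_prod; apply: eq_bigr => i _; rewrite rmorph_sum.
  by apply: eq_bigr => j _; rewrite /= map_polyXn.
have /dvdzP [u Eu] : (3 %| (G ^+ 2 * theta G)`_n)%Z.
  rewrite (dvdz_pcharf ch3) -coef_map_id0 //.
  rewrite rmorphM rmorphXn /= /theta rmorphM /= map_polyX -deriv_map mapG.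
  by rewrite -/(theta _) coef_square_theta.
have : ((RD 3 l t n * n)%N%:R = u * 9 :> int).
  rewrite natrM RD_coef mulr_natr -coef_theta theta_cube coefMn Eu; lia.
rewrite natz => E.
have : (9 %| RD 3 l t n * n)%N by lia.
by rewrite Gauss_dvdl // -[9%N]/(3 ^ 2)%N coprimeXl // prime_coprime //; lia.
Qed.

Close Scope ring_scope.

Theorem corollary1p4 : forall n : nat, RD 3 3 27 (3 * n + 2) = 0 %[mod 3 ^ 2].
Proof.
move=> n; apply/eqP; rewrite mod0n -/(dvdn _ _).
by apply: RD_mod9; rewrite // mulnC modnMDl.
Qed.
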